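(* Let $X$ be a finite nonempty set, let $\mathcal E^0$ be a nonempty collection of nonempty subsets of $X$, and let $\{\mu_E:E\in\mathcal E^0\}$ be an overlap compatible family of normalized capacities $\mu_E\colon2^E\to[0,1]$. Let $\mathcal C_{\rm glob}$ be the set of all normalized capacities $\mu$ on $X$ with $\mu(B)=\mu_E(B)$ for all $E\in\mathcal E^0$ and $B\subseteq E$, and let $\mu_*$ and $\mu^*$ be the extremal completions of the family. If $\mathfrak U$ is a capacity monotone integral scheme, then for every $f\in[0,1]^X$ $$\mathfrak U_{\mu_*}(f)=\min_{\mu\in\mathcal C_{\rm glob}}\mathfrak U_\mu(f)\le\max_{\mu\in\mathcal C_{\rm glob}}\mathfrak U_\mu(f)=\mathfrak U_{\mu^*}(f)$$ (in particular the minimum and maximum exist). Hence both endpoints are attained, and $[\mathfrak U_{\mu_*}(f),\mathfrak U_{\mu^*}(f)]$ is the smallest interval containing all scores $\mathfrak U_\mu(f)$, $\mu\in\mathcal C_{\rm glob}$.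
   Context: A normalized capacity on a finite nonempty set $Y$ is a map $\mu\colon2^Y\to[0,1]$ with $\mu(\emptyset)=0$, $\mu(Y)=1$, and $\mu(A)\le\mu(B)$ whenever $A\subseteq B\subseteq Y$. A set function is monotone if it is nondecreasing with respect to inclusion. The family $\{\mu_E\}$ is overlap compatible if $\mu_E(B)=\mu_F(B)$ for all $E,F\in\mathcal E^0$ and all $B\subseteq E\cap F$. Extremal completions: put $\mathcal D_0:=\bigcup_{E\in\mathcal E^0}2^E$, $\mathcal D:=\mathcal D_0\cup\{X\}$; let $\nu(B)$ be the common value of $\mu_E(B)$ over all $E\in\mathcal E^0$ with $B\subseteq E$, for $B\in\mathcal D_0$, and $\nu(X)=1$ when $X\notin\mathcal D_0$. Then for $A\subseteq X$, $\mu_*(A):=\max\{\nu(B):B\in\mathcal D,\ B\subseteq A\}$ and $\mu^*(A):=\min\{\nu(C):C\in\mathcal D,\ A\subseteq C\}$. An integral scheme $\mathfrak U$ assigns to every finite set $E$, every monotone set function $\mu\colon2^E\to[0,1]$ with $\mu(\emptyset)=0$, and every $u\in[0,1]^E$ a value $\mathfrak U_\mu(u)\in[0,1]$. It is capacity monotone if, for monotone set functions $\mu,\lambda\colon 2^E\to[0,1]$ vanishing at $\emptyset$, $\mu\le\lambda$ pointwise implies $\mathfrak U_\mu(u)\le\mathfrak U_\lambda(u)$ for every $u\in[0,1]^E$. *)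

(* Defs.v *)
From mathcomp Require Import classical_sets set_interval reals.
From mathcomp Require Import all_boot all_order all_algebra.

Set Implicit Arguments.
Unset Strict Implicit.
Unset Printing Implicit Defensive.

Import Order.TTheory GRing.Theory Num.Theory.
Local Open Scope ring_scope.

Section SetFunctions.
Variables (R : realType) (Y : finType).
Implicit Type mu : {set Y} -> R.

Definition grounded_monotone mu : Prop :=
  [/\ forall A, 0 <= mu A <= 1,
      mu set0 = 0
    & forall A B : {set Y}, A \subset B -> mu A <= mu B].

Definition normalized_capacity mu : Prop :=
  grounded_monotone mu /\ mu [set: Y] = 1.

End SetFunctions.

Section IntegralSchemes.
Variable R : realType.

(* A scheme is a total function; its values outside the domain described in
   [integral_scheme] are never constrained. *)
Definition scheme := forall E : finType, ({set E} -> R) -> (E -> R) -> R.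

Definition integral_scheme (U : scheme) : Prop :=
  forall (E : finType) (mu : {set E} -> R) (u : E -> R),
    grounded_monotone mu -> (forall x, 0 <= u x <= 1) ->
    0 <= U E mu u <= 1.

Definition capacity_monotone (U : scheme) : Prop :=
  forall (E : finType) (mu lambda : {set E} -> R),
    grounded_monotone mu -> grounded_monotone lambda ->
    (forall A, mu A <= lambda A) ->
    forall u : E -> R, (forall x, 0 <= u x <= 1) ->
    U E mu u <= U E lambda u.

End IntegralSchemes.

(* A subset B of E, viewed as a set of elements of the type of points of E. *)
Definition trace (X : finType) (E B : {set X}) : {set {x : X | x \in E}} :=
  [set x | val x \in B].

Section Completions.
Variables (R : realType) (X : finType) (E0 : {set {set X}}).
(* Only the members mu E with E \in E0 matter. *)
Variable mu : forall E : {set X}, {set {x : X | x \in E}} -> R.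

Definition overlap_compatible : Prop :=
  forall E F : {set X}, E \in E0 -> F \in E0 ->
  forall B : {set X}, B \subset E :&: F ->
  mu (trace E B) = mu (trace F B).

Definition C_glob : set ({set X} -> R) :=
  [set m | normalized_capacity m /\
           forall E, E \in E0 ->
           forall B : {set X}, B \subset E -> m B = mu (trace E B)]%classic.

Definition D0 : {set {set X}} := \bigcup_(E in E0) powerset E.

Definition D : {set {set X}} := [set: X] |: D0.

(* For an overlap compatible family the choice of E is irrelevant, see [nuE].
   On D, the default value 1 is used only at X, when X is not in D0. *)
Definition nu (B : {set X}) : R :=
  if [pick E in E0 | B \subset E] is Some E then mu (trace E B) else 1.

(* When E0 is nonempty, set0 is in D; hence the initial value nu set0 is one of
   the values over which the maximum is taken. Likewise for nu setT below. *)
Definition lower_completion (A : {set X}) : R :=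
  \big[Num.max/nu set0]_(B in D | B \subset A) nu B.

Definition upper_completion (A : {set X}) : R :=
  \big[Num.min/nu [set: X]]_(C in D | A \subset C) nu C.

Lemma nuE (E B : {set X}) : overlap_compatible ->
  E \in E0 -> B \subset E -> nu B = mu (trace E B).
Proof.
move=> compat EE0 BE; rewrite /nu; case: pickP => [F /andP[FE0 BF]|/(_ E)].
  by apply: compat => //; rewrite subsetI BF.
by rewrite EE0 BE.
Qed.

End Completions.

Section Extrema.
Variable R : realType.
Local Open Scope classical_set_scope.

Definition is_min (S : set R) (m : R) : Prop := S m /\ lbound S m.

Definition is_max (S : set R) (m : R) : Prop := S m /\ ubound S m.

Definition smallest_interval (S : set R) (J : interval R) : Prop :=
  S `<=` [set` J] /\
  forall K : interval R, S `<=` [set` K] -> [set` J] `<=` [set` K].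

End Extrema.

(* Main.v *)
Require Import Defs.
From mathcomp Require Import classical_sets set_interval reals.
From mathcomp Require Import all_boot all_order all_algebra.

Set Implicit Arguments.
Unset Strict Implicit.
Unset Printing Implicit Defensive.

Import Order.TTheory GRing.Theory Num.Theory.
Local Open Scope ring_scope.

(** [nu] is monotone on [D]: unless the larger of two nested members is [X],
where [nu] takes its maximal value 1, both lie in a common [E \in E0] and
[mu E] compares them. Hence both completions are normalized capacities extending
the family; every global extension agrees with [nu] on [D] and so lies between
them, and capacity monotonicity transfers this sandwich to the scores. *)

Lemma traceS (X : finType) (E B C : {set X}) :
  B \subset C -> trace E B \subset trace E C.
Proof. by move=> /subsetP BC; apply/subsetP => x; rewrite !inE; apply: BC. Qed.

Lemma trace0 (X : finType) (E : {set X}) : trace E set0 = set0.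
Proof. by apply/setP => x; rewrite !inE. Qed.

Lemma trace_id (X : finType) (E : {set X}) : trace E E = [set: _].
Proof. by apply/setP => x; rewrite !inE (valP x). Qed.

Section CompatibleFamily.
Variables (R : realType) (X : finType) (E0 : {set {set X}}).
Variable mu : forall E : {set X}, {set {x : X | x \in E}} -> R.
Hypothesis E0_neq0 : E0 != set0.
Hypothesis mu_cap : forall E, E \in E0 -> normalized_capacity (@mu E).
Hypothesis mu_compat : overlap_compatible E0 mu.

Local Notation D := (D E0).
Local Notation nu := (nu E0 mu).
Local Notation lower := (lower_completion E0 mu).
Local Notation upper := (upper_completion E0 mu).

Lemma mem_D (E B : {set X}) : E \in E0 -> B \subset E -> B \in D.
Proof.
move=> EE0 BE; rewrite inE; apply/orP; right.
by apply/bigcupP; exists E; rewrite ?inE.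
Qed.

(** The cases may overlap, since [X] itself can belong to [E0]; arguments by this view treat each
    case independently. *)
Variant mem_D_spec (B : {set X}) : Prop :=
| MemDTop of B = [set: X]
| MemDLocal E of E \in E0 & B \subset E.

Lemma mem_DP (B : {set X}) : B \in D -> mem_D_spec B.
Proof.
rewrite in_setU1 => /predU1P[->|]; first by left.
by case/bigcupP => E EE0; rewrite inE; right with E.
Qed.

Lemma setT_D : [set: X] \in D.
Proof. by rewrite setU11. Qed.

Lemma set0_D : set0 \in D.
Proof. by have [E EE0] := set0Pn _ E0_neq0; apply: (mem_D EE0); rewrite sub0set. Qed.

Lemma nu_ge0_le1 (B : {set X}) : 0 <= nu B <= 1.
Proof.
rewrite /Defs.nu; case: pickP => [E /andP[EE0 _]|_]; last by rewrite ler01 lexx.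
by have [[mu01 _ _] _] := mu_cap EE0.
Qed.

Lemma nu_set0 : nu set0 = 0.
Proof.
have [E EE0] := set0Pn _ E0_neq0.
rewrite (nuE mu_compat EE0) ?sub0set // trace0.
by have [[_ -> _] _] := mu_cap EE0.
Qed.

Lemma nu_setT : nu [set: X] = 1.
Proof.
(* If some member of [E0] contains [X], it equals [X] and its capacity is normalized; otherwise the
   default value 1 applies. *)
rewrite /Defs.nu; case: pickP => // E /andP[EE0]; rewrite subTset => /eqP <-.
by rewrite trace_id; have [_ ->] := mu_cap EE0.
Qed.

(** Membership in [D] is asked of the larger set only: below a local [C] the set [B] is local too,
    and below [X] the bound [nu B <= 1] holds even for [B] outside [D], where [nu] defaults to 1. *)
Lemma nu_mono (B C : {set X}) : C \in D -> B \subset C -> nu B <= nu C.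
Proof.
move=> /mem_DP[->|E EE0 CE] BC.
  by rewrite nu_setT; have /andP[] := nu_ge0_le1 B.
rewrite (nuE mu_compat EE0 CE) (nuE mu_compat EE0 (subset_trans BC CE)).
by have [[_ _ mono] _] := mu_cap EE0; apply/mono/traceS.
Qed.

(** For [B] in [D], the set [B] itself competes in the maximum, and by monotonicity of [nu] no other
    competitor, nor the initial value [nu set0], exceeds it. *)
Lemma lower_completion_nu (B : {set X}) : B \in D -> lower B = nu B.
Proof.
move=> BD; apply/le_anti/andP; split.
  apply: bigmax_le => [|C /andP[CD CB]]; first by rewrite nu_mono ?sub0set.
  exact: nu_mono.
by apply: le_bigmax_cond; rewrite BD subxx.
Qed.

Lemma upper_completion_nu (B : {set X}) : B \in D -> upper B = nu B.
Proof.
move=> BD; apply/le_anti/andP; split.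
  by apply: bigmin_le_cond; rewrite BD subxx.
apply: le_bigmin => [|C /andP[CD CB]]; first by rewrite nu_mono ?subsetT ?setT_D.
exact: nu_mono.
Qed.

(** Both [set0] and [X] lie in [D], so agreement with [nu] fixes the values 0 and 1 there, and
    monotonicity squeezes all other values between them. *)
Lemma C_globP (m : {set X} -> R) :
    (forall A B : {set X}, A \subset B -> m A <= m B) ->
    (forall B, B \in D -> m B = nu B) -> C_glob E0 mu m.
Proof.
move=> mono mnu; have m0 : m set0 = 0 by rewrite mnu ?set0_D ?nu_set0.
have mT : m [set: X] = 1 by rewrite mnu ?setT_D ?nu_setT.
split=> [|E EE0 B BE]; last by rewrite mnu ?(nuE mu_compat EE0) ?(mem_D EE0).
by split=> //; split=> // A; rewrite -{1}m0 -mT !mono ?sub0set ?subsetT.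
Qed.

Lemma lower_completion_C_glob : C_glob E0 mu lower.
Proof.
apply: C_globP lower_completion_nu => A B AB.
(* Enlarging [A] only adds competitors to the maximum. *)
apply: bigmax_le => [|C /andP[CD CA]]; first exact: bigmax_ge_id.
by apply: le_bigmax_cond; rewrite CD (subset_trans CA).
Qed.

Lemma upper_completion_C_glob : C_glob E0 mu upper.
Proof.
apply: C_globP upper_completion_nu => A B AB.
apply: le_bigmin => [|C /andP[CD BC]]; first exact: bigmin_le_id.
by apply: bigmin_le_cond; rewrite CD (subset_trans AB).
Qed.

Lemma C_glob_nu (m : {set X} -> R) (B : {set X}) :
  C_glob E0 mu m -> B \in D -> m B = nu B.
Proof.
move=> [[_ mT] mE] /mem_DP[->|E EE0 BE]; first by rewrite mT nu_setT.
by rewrite (mE E) // (nuE mu_compat EE0).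
Qed.

Lemma lower_completion_le (m : {set X} -> R) (A : {set X}) :
  C_glob E0 mu m -> lower A <= m A.
Proof.
move=> Cm; have [[[_ _ mono] _] _] := Cm.
(* Each competing value, the initial one included, is a value of [m] at a subset of [A]. *)
apply: bigmax_le => [|B /andP[BD BA]]; rewrite -(C_glob_nu Cm) ?set0_D //.
  by rewrite mono ?sub0set.
exact: mono.
Qed.

Lemma upper_completion_ge (m : {set X} -> R) (A : {set X}) :
  C_glob E0 mu m -> m A <= upper A.
Proof.
move=> Cm; have [[[_ _ mono] _] _] := Cm.
apply: le_bigmin => [|B /andP[BD AB]]; rewrite -(C_glob_nu Cm) ?setT_D //.
  by rewrite mono ?subsetT.
exact: mono.
Qed.

End CompatibleFamily.

(** Any interval containing the attained values [a] and [b] contains all points between them,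
    whether its own ends are open, closed or infinite. *)
Lemma smallest_interval_min_max (R : realType) (S : set R) (a b : R) :
  is_min S a -> is_max S b -> smallest_interval S `[a, b]%R.
Proof.
move=> [Sa lba] [Sb ubb]; split=> [x Sx|[l r] SK] /=.
  by rewrite in_itv /= lba ?ubb.
(* Membership of [a] and [b] becomes a comparison of interval bounds, the form needed for interval
   inclusion. *)
have:= SK _ Sa; have := SK _ Sb; rewrite /= !itv_boundlr.
by move=> /andP[_ br] /andP[la _]; apply: subset_itv.
Qed.

Local Open Scope classical_set_scope.

Theorem theorem6p6 (R : realType) (X : finType) (E0 : {set {set X}})
    (mu : forall E : {set X}, {set {x : X | x \in E}} -> R)
    (U : scheme R) :
  (0 < #|X|)%N ->
  E0 != set0 ->
  set0 \notin E0 ->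
  (forall E : {set X}, E \in E0 -> normalized_capacity (@mu E)) ->
  overlap_compatible E0 mu ->
  integral_scheme U ->
  capacity_monotone U ->
  forall f : X -> R, (forall x, 0 <= f x <= 1) ->
  let scores := [set U X m f | m in C_glob E0 mu] in
  let lo := U X (lower_completion E0 mu) f in
  let hi := U X (upper_completion E0 mu) f in
  [/\ is_min scores lo,
      lo <= hi,
      is_max scores hi
    & smallest_interval scores `[lo, hi]%R].
Proof.
move=> _ E0_neq0 _ mu_cap mu_compat _ Umono f f01 scores lo hi.
have Clo := lower_completion_C_glob E0_neq0 mu_cap mu_compat.
have Chi := upper_completion_C_glob E0_neq0 mu_cap mu_compat.
have grounded m : C_glob E0 mu m -> grounded_monotone m by case=> [[]].
have min_lo : is_min scores lo.
  split=> [|_ [m Cm <-]]; first by exists (lower_completion E0 mu).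
  by apply: Umono => // [||A]; [exact: grounded..|exact: lower_completion_le].
have max_hi : is_max scores hi.
  split=> [|_ [m Cm <-]]; first by exists (upper_completion E0 mu).
  by apply: Umono => // [||A]; [exact: grounded..|exact: upper_completion_ge].
split=> //; last exact: smallest_interval_min_max.
(* The score [hi] is attained, so the lower bound [lo] applies to it. *)
by apply: min_lo.2; exact: max_hi.1.
Qed.
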